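(* Let $G=(V,E)$ be a connected finite graph with symmetric positive edge weights $w_{xy}$ and positive vertex measure $\mu$, let $N\ge 1$ be an integer and let $p_1,\dots,p_N\in V$ be distinct vertices. For $\lambda>0$ consider the equation $$\Delta u=\lambda e^{u}\left(e^{u}-1\right)^{5}+4\pi\sum_{s=1}^{N}\delta_{p_s}\quad\text{on } V \qquad (\ast_\lambda)$$ for an unknown function $u:V\to\mathbb{R}$. Then there exists a critical value $\hat\lambda$ with $$\hat\lambda\ \ge\ \frac{6^6}{5^5}\,\frac{4\pi N}{\mathrm{Vol}(V)}$$ such that: if $\lambda>\hat\lambda$, then $(\ast_\lambda)$ has at least two solutions; if $\lambda=\hat\lambda$, then $(\ast_\lambda)$ has a solution; and if $0<\lambda<\hat\lambda$, then $(\ast_\lambda)$ has no solution.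
   Context: $G=(V,E)$ is a connected finite graph with vertex set $V$ and edge set $E$; each edge $xy\in E$ has a weight $w_{xy}=w_{yx}>0$, and $\mu:V\to(0,+\infty)$ is a measure. Write $y\sim x$ if $xy\in E$. For $u:V\to\mathbb{R}$ the Laplacian is $\Delta u(x)=\frac{1}{\mu(x)}\sum_{y\sim x}w_{yx}(u(y)-u(x))$. The volume is $\mathrm{Vol}(V)=\sum_{x\in V}\mu(x)$, and $\int_V u\,d\mu=\sum_{x\in V}\mu(x)u(x)$. $\delta_p$ denotes the Dirac mass at the vertex $p$, i.e. $\delta_p(p)=1/\mu(p)$ and $\delta_p(x)=0$ for $x\ne p$ (so that $\int_V\delta_p\,d\mu=1$). *)

(* Defs.v *)
From HB Require Import structures.
From mathcomp Require Import all_boot all_order all_algebra.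
From mathcomp Require Import reals sequences exp trigo.

Set Implicit Arguments.
Unset Strict Implicit.
Unset Printing Implicit Defensive.
Import Order.TTheory GRing.Theory Num.Theory.

Local Open Scope ring_scope.

(* A finite connected graph on V with adjacency relation adj. The weight w is
   constrained only on edges, and no operation below reads it elsewhere.
   A loop at x would contribute w x x * (u x - u x) = 0 to the Laplacian, so
   loops are not excluded. *)
Record weighted_graph (R : realType) (V : finType) := WeightedGraph {
  adj : rel V;
  weight : V -> V -> R;
  vmeas : V -> R;
  adj_sym : symmetric adj;
  adj_connected : forall x y : V, connect adj x y;
  weight_sym : forall x y : V, adj x y -> weight x y = weight y x;
  weight_gt0 : forall x y : V, adj x y -> 0 < weight x y;
  vmeas_gt0 : forall x : V, 0 < vmeas x
}.

Section GraphCalculus.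
Variables (R : realType) (V : finType) (G : weighted_graph R V).

Definition graph_laplacian (u : V -> R) (x : V) : R :=
  (vmeas G x)^-1 * \sum_(y | adj G x y) weight G y x * (u y - u x).

Definition graph_volume : R := \sum_(x : V) vmeas G x.

(* Dirac mass normalised with respect to the vertex measure: it integrates
   to 1 against vmeas G. *)
Definition dirac_mass (p x : V) : R :=
  if x == p then (vmeas G p)^-1 else 0.

Definition is_solution (N : nat) (p : 'I_N -> V) (lambda : R) (u : V -> R)
    : Prop :=
  forall x : V,
    graph_laplacian u x =
      lambda * expR (u x) * (expR (u x) - 1) ^+ 5
      + 4 * pi * \sum_(s < N) dirac_mass (p s) x.

End GraphCalculus.

(* Main.v *)
Require Import Defs.
From HB Require Import structures.
From mathcomp Require Import all_boot all_order all_algebra.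
From mathcomp Require Import ring lra.
From mathcomp Require Import boolp classical_sets functions reals.
From mathcomp Require Import topology normedtype sequences derive realfun.
From mathcomp Require Import exp trigo.

(* Solutions are negative by the maximum principle; integrating the equation
   and maximising z (1 - z)^5 at z = 1/6 bounds lambda from below. A solution at
   l is a strict subsolution at every larger parameter, so the set of solvable
   parameters is upward closed; the critical value is its infimum.

   Existence at the infimum is by compactness: negative functions with small
   residual are uniformly bounded below, since integrating the residual gives a
   vertex where u is not too negative and the bound on the Laplacian propagates
   this to the neighbours.

   Above the infimum, take a strict subsolution u and the explicit Euler map
   T v = v + tau * residual v, with tau so small that T preserves the order on
   {v <= 0} and decreases the energy. The orbit of u increases, which gives a
   solution above u. On the half-line u - s, the points whose orbit climbs above
   u and those whose energy eventually drops below a lower bound of the energy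
   on [u, 0] form two disjoint open sets, both nonempty; the orbit of a point in
   neither has bounded energy, hence arbitrarily small residuals, and it
   accumulates at a solution that is not above u. *)

Set Implicit Arguments.
Unset Strict Implicit.
Unset Printing Implicit Defensive.
Import Order.TTheory GRing.Theory Num.Theory.
Import numFieldTopology.Exports numFieldNormedType.Exports.

Local Open Scope classical_set_scope.
Local Open Scope ring_scope.

(** * The nonlinearity and its primitive on the negative half-line *)

Section Nonlinearity.
Variable R : realType.
Implicit Types s t : R.

Definition nonlin t : R := expR t * (expR t - 1) ^+ 5.
Definition nonlin_primitive t : R := (expR t - 1) ^+ 6 / 6.

Lemma nonlin0 : nonlin 0 = 0.
Proof. by rewrite /nonlin expR0 subrr expr0n mulr0. Qed.

Lemma nonlin_primitive_ge0 t : 0 <= nonlin_primitive t.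
Proof. by rewrite /nonlin_primitive divr_ge0// exprn_even_ge0. Qed.

Lemma nonlin_primitive_le1 t : t <= 0 -> nonlin_primitive t <= 1.
Proof.
rewrite -expR_le1 /nonlin_primitive => e1; have e0 := expR_gt0 t.
have -> : (expR t - 1) ^+ 6 = (1 - expR t) ^+ 6 by ring.
rewrite ler_pdivrMr// mul1r (@le_trans _ _ 1)//; last by lra.
by rewrite exprn_ile1//; lra.
Qed.

Lemma nonlin_lt0 t : t < 0 -> nonlin t < 0.
Proof.
rewrite -expR_lt1 /nonlin => e1.
by rewrite pmulr_rlt0 ?expR_gt0// exprn_odd_lt0// subr_lt0.
Qed.

Lemma nonlin_le0 t : (nonlin t <= 0) = (t <= 0).
Proof.
by rewrite /nonlin pmulr_rle0 ?expR_gt0// exprn_odd_le0// subr_le0 expR_le1.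
Qed.

(** Sharp at expR t = 1/6; the reciprocal of 5^5/6^6 becomes the factor in the lower bound on the
    critical value. *)
Lemma nonlin_ge t : - (5 ^+ 5 / 6 ^+ 6) <= nonlin t.
Proof.
case: (leP 0 t) => [t0|t0].
  apply: (@le_trans _ _ 0).
    by rewrite oppr_le0 divr_ge0 ?exprn_ge0.
  rewrite /nonlin mulr_ge0 ?expR_ge0// exprn_ge0// subr_ge0.
  by rewrite -[1]expR0 ler_expR.
have := t0; rewrite -expR_lt1 /nonlin => e1; have e0 := expR_gt0 t.
move: (expR t) e0 e1 => x x0 x1; rewrite -subr_ge0.
pose s := 1 - x; have s0 : 0 <= s by rewrite /s; lra.
(* The quotient by the double root (s - 5/6)^2 has positive coefficients. *)
have -> : x * (x - 1) ^+ 5 - - (5 ^+ 5 / 6 ^+ 6) =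
  (s - 5 / 6) ^+ 2 *
  (s ^+ 4 + 2 / 3 * s ^+ 3 + 5 / 12 * s ^+ 2 + 25 / 108 * s + 125 / 1296).
  by rewrite /s; field.
apply: mulr_ge0; first exact: sqr_ge0.
have := exprn_ge0 4 s0; have := exprn_ge0 3 s0; have := exprn_ge0 2 s0.
by lra.
Qed.

Lemma nonlin_geN1 t : -1 <= nonlin t.
Proof. by apply: le_trans (nonlin_ge t); rewrite lerN2; lra. Qed.

Lemma nonlin_geNexpR t : t <= 0 -> - expR t <= nonlin t.
Proof.
rewrite -expR_le1 /nonlin => e1; have e0 := expR_gt0 t.
have -> : expR t * (expR t - 1) ^+ 5 = - (expR t * (1 - expR t) ^+ 5) by ring.
rewrite lerN2.
by rewrite ler_piMr ?expR_ge0// exprn_ile1//; lra.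
Qed.

Lemma nonlin_lip s t : s <= t -> t <= 0 ->
  `|nonlin t - nonlin s| <= 6 * (t - s).
Proof.
move=> st t0; have s0 := le_trans st t0.
have tst : expR t - expR s <= t - s.
  have : expR t * (1 + (s - t)) <= expR t * expR (s - t).
    by rewrite ler_pM2l ?expR_gt0// expR_ge1Dx.
  rewrite -expRD [t + _]addrC subrK.
  have : expR t <= 1 by rewrite expR_le1.
  have := expR_gt0 t.
  move: (expR t) (expR s) => a b; move: st; nra.
have es0 := expR_gt0 s; have et0 := expR_gt0 t.
have := t0; have := st; rewrite -expR_le1 -ler_expR => est et1.
rewrite /nonlin; move: (expR t) (expR s) et0 es0 est et1 tst => a b a0 b0 ba a1.
move=> abts; apply: (@le_trans _ _ (6 * (a - b))); last by lra.
(* Since a - b = y - x, the difference factors through a - b; the cofactor b S - x^5 lies in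
   [-1, 5]. *)
pose x := 1 - a; pose y := 1 - b.
have x0 : 0 <= x <= 1 by rewrite /x; lra.
have y0 : 0 <= y <= 1 by rewrite /y; lra.
have pow n : 0 <= x ^+ n <= 1 by rewrite exprn_ge0 ?exprn_ile1//; lra.
have qow n : 0 <= y ^+ n <= 1 by rewrite exprn_ge0 ?exprn_ile1//; lra.
have -> : a * (a - 1) ^+ 5 - b * (b - 1) ^+ 5 =
   (a - b) * (b * (x ^+ 4 + x ^+ 3 * y ^+ 1 + x ^+ 2 * y ^+ 2
                   + x ^+ 1 * y ^+ 3 + y ^+ 4)
    - x ^+ 5).
  by rewrite /x /y; ring.
rewrite normrM ger0_norm; last by lra.
rewrite mulrC ler_wpM2r//; first by lra.
have pq m n : 0 <= x ^+ m * y ^+ n <= 1.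
  have /andP[? ?] := pow m; have /andP[? ?] := qow n.
  by rewrite mulr_ge0//= mulr_ile1.
have /andP[? ?] := pq 3%N 1%N; have /andP[? ?] := pq 2%N 2%N.
have /andP[? ?] := pq 1%N 3%N; have /andP[? ?] := pow 4%N.
have /andP[? ?] := qow 4%N; have /andP[? ?] := pow 5%N.
set S := (X in b * X); have S0 : 0 <= S by rewrite /S; lra.
have S5 : S <= 5 by rewrite /S; lra.
have bS0 : 0 <= b * S by rewrite mulr_ge0// ltW.
have bS5 : b * S <= 1 * 5.
  by apply: ler_pM => //; [exact: ltW|exact: le_trans ba a1].
by rewrite ler_norml; apply/andP; split; lra.
Qed.

Lemma is_derive_nonlin_primitive t :
  is_derive t 1 nonlin_primitive (nonlin t).
Proof.
have -> : nonlin_primitive = 6^-1 \*: (expR - cst 1) ^+ 6.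
  by apply/funext => x; rewrite /nonlin_primitive mulrC.
apply: is_derive_eq; rewrite /nonlin subr0 /= -[_ *: _]/(_ * _).
rewrite -[_ *: expR t]/(_ * expR t) -[(expR - cst 1) t]/(expR t - 1).
by field.
Qed.

(** Mean value theorem plus the Lipschitz bound; the quadratic remainder controls the energy change
    in one Euler step. *)
Lemma nonlin_primitive_taylor s t : s <= 0 -> t <= 0 ->
  nonlin_primitive t - nonlin_primitive s <=
    nonlin s * (t - s) + 6 * (t - s) ^+ 2.
Proof.
have contF (A : set R) : {within A, continuous nonlin_primitive}.
  apply: continuous_subspaceT => x.
  apply/differentiable_continuous/derivable1_diffP.
  by have [] := is_derive_nonlin_primitive x.
have mvt a b : a <= b -> exists2 c, a <= c <= b &
    nonlin_primitive b - nonlin_primitive a = nonlin c * (b - a).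
  move=> ab; have [c] := MVT_segment ab
    (fun x _ => is_derive_nonlin_primitive x) (contF _).
  by rewrite in_itv/= => ? ?; exists c.
move=> s0 t0; have [st|ts] := leP s t.
  have [c /andP[sc ct] ->] := mvt _ _ st.
  have := nonlin_lip sc (le_trans ct t0); rewrite ler_norml => /andP[_ h].
  have : nonlin c * (t - s) <= (nonlin s + 6 * (t - s)) * (t - s).
    by rewrite ler_wpM2r//; lra.
  by rewrite expr2; lra.
have [c /andP[tc cs] eF] := mvt _ _ (ltW ts).
have := nonlin_lip cs s0; rewrite ler_norml => /andP[h1 h2].
have : (nonlin s + 6 * (t - s)) * (s - t) <= nonlin c * (s - t).
  by rewrite ler_wpM2r//; lra.
by rewrite expr2; lra.
Qed.

End Nonlinearity.

(** * Summation by parts, Dirichlet form and energy *)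

Section Graph.
Variables (R : realType) (V : finType) (G : weighted_graph R V).
Implicit Types (u v h src : V -> R) (x y : V) (lam t : R).

Local Notation mu := (vmeas G).
Local Notation lap := (graph_laplacian G).

(** Extending the weight by zero lets sums range over all of V, so that the two indices can be
    exchanged. *)
Definition conductance x y : R := if adj G x y then weight G y x else 0.
Definition degree x : R := \sum_y conductance x y.
(** The factor 1/4 accounts for each edge being counted twice and makes minus the Laplacian the
    gradient with respect to the measure. *)
Definition dirichlet u : R :=
  4^-1 * \sum_x \sum_y conductance x y * (u y - u x) ^+ 2.

Lemma conductance_sym x y : conductance x y = conductance y x.
Proof.
rewrite /conductance adj_sym; case: ifP => // xy.
exact: weight_sym.
Qed.

Lemma conductance_ge0 x y : 0 <= conductance x y.
Proof.
by rewrite /conductance adj_sym; case: ifP => // /(@weight_gt0 _ _ G)/ltW.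
Qed.

Lemma conductance_gt0 x y : adj G x y -> 0 < conductance x y.
Proof.
by rewrite /conductance => xy; rewrite xy weight_gt0// adj_sym.
Qed.

Lemma degree_ge0 x : 0 <= degree x.
Proof. by apply: sumr_ge0 => y _; exact: conductance_ge0. Qed.

Lemma vmeas_laplacian u x :
  mu x * lap u x = \sum_y conductance x y * (u y - u x).
Proof.
rewrite /graph_laplacian mulrA divff ?gt_eqF ?vmeas_gt0// mul1r big_mkcond/=.
by apply: eq_bigr => y _; rewrite /conductance; case: ifP => //; rewrite mul0r.
Qed.

Lemma graph_ind (P : V -> Prop) x0 :
  P x0 -> (forall x y, adj G x y -> P x -> P y) -> forall x, P x.
Proof.
move=> P0 PS x; have /connectP[s] := adj_connected G x0 x.
elim: s x0 P0 => [|y s ih] z Pz /=; first by move=> _ ->.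
by case/andP => zy; apply: ih; exact: PS zy Pz.
Qed.

Lemma sum_conductance_swap (f : V -> V -> R) :
  \sum_x \sum_y conductance x y * f x y = \sum_x \sum_y conductance x y * f y x.
Proof.
rewrite exchange_big/=; apply: eq_bigr => x _; apply: eq_bigr => y _.
by rewrite conductance_sym.
Qed.

Lemma green u h :
  \sum_x mu x * lap u x * h x =
    - (2^-1 * \sum_x \sum_y conductance x y * ((u y - u x) * (h y - h x))).
Proof.
have -> : \sum_x mu x * lap u x * h x =
    \sum_x \sum_y conductance x y * ((u y - u x) * h x).
  apply: eq_bigr => x _; rewrite vmeas_laplacian mulr_suml.
  by apply: eq_bigr => y _; rewrite mulrA.
(* Exchanging x and y gives a second form of [A], with h y; combining the two forms symmetrises the
   sum. *)
set A := LHS; have AE := sum_conductance_swap (fun x y => (u y - u x) * h x).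
rewrite -/A/= in AE.
have -> : \sum_x \sum_y conductance x y * ((u y - u x) * (h y - h x)) = - A - A.
  rewrite {1}AE -!sumrN -big_split/=; apply: eq_bigr => x _.
  by rewrite -!sumrN -big_split/=; apply: eq_bigr => y _; ring.
by field.
Qed.

Lemma sum_laplacian u : \sum_x mu x * lap u x = 0.
Proof.
have := green u (fun=> 1).
rewrite [X in _ * X]big1 => [|x _]; last first.
  by rewrite big1// => y _; rewrite subrr !mulr0.
by rewrite mulr0 oppr0; under eq_bigr do rewrite mulr1.
Qed.

Lemma dirichlet_ge0 u : 0 <= dirichlet u.
Proof.
rewrite mulr_ge0 ?invr_ge0//; apply: sumr_ge0 => x _; apply: sumr_ge0 => y _.
by rewrite mulr_ge0 ?conductance_ge0 ?sqr_ge0.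
Qed.

Lemma dirichletD u h : dirichlet (fun x => u x + h x) =
  dirichlet u - \sum_x mu x * lap u x * h x + dirichlet h.
Proof.
rewrite green opprK /dirichlet.
have -> : 2^-1 = 4^-1 * 2 :> R by field.
rewrite -mulrA -!mulrDr; congr (_ * _).
rewrite mulr_sumr -!big_split/=; apply: eq_bigr => x _.
by rewrite mulr_sumr -!big_split/=; apply: eq_bigr => y _; ring.
Qed.

Lemma dirichlet_le h : dirichlet h <= \sum_x degree x * h x ^+ 2.
Proof.
have E : \sum_x degree x * h x ^+ 2 =
    \sum_x \sum_y conductance x y * h x ^+ 2.
  by apply: eq_bigr => x _; rewrite mulr_suml.
have -> : \sum_x degree x * h x ^+ 2 =
    4^-1 * \sum_x \sum_y conductance x y * (2 * h x ^+ 2 + 2 * h y ^+ 2).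
  have S := sum_conductance_swap (fun x y => h x ^+ 2); rewrite /= -E in S.
  have -> : \sum_x \sum_y conductance x y * (2 * h x ^+ 2 + 2 * h y ^+ 2) =
     2 * \sum_x degree x * h x ^+ 2 + 2 * \sum_x degree x * h x ^+ 2.
    rewrite {1}E S !mulr_sumr -big_split/=; apply: eq_bigr => x _.
    by rewrite !mulr_sumr -big_split/=; apply: eq_bigr => y _; ring.
  by field.
rewrite ler_wpM2l ?invr_ge0//; apply: ler_sum => x _; apply: ler_sum => y _.
rewrite ler_wpM2l ?conductance_ge0// -subr_ge0.
have -> : 2 * h x ^+ 2 + 2 * h y ^+ 2 - (h y - h x) ^+ 2 = (h x + h y) ^+ 2.
  by ring.
exact: sqr_ge0.
Qed.

(** Minus the gradient of [graph_energy] for the inner product weighted by the measure; solutions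
    are its zeros. *)
Definition residual lam src u x : R := lap u x - lam * nonlin (u x) - src x.

Definition graph_energy lam src u : R := dirichlet u +
  \sum_x mu x * (lam * nonlin_primitive (u x) + src x * u x).

Lemma sum_residual lam src u : \sum_x mu x * residual lam src u x =
  - (lam * \sum_x mu x * nonlin (u x)) - \sum_x mu x * src x.
Proof.
transitivity (\sum_x mu x * lap u x - lam * (\sum_x mu x * nonlin (u x))
    - \sum_x mu x * src x); last by rewrite sum_laplacian sub0r.
rewrite mulr_sumr -!sumrB.
by apply: eq_bigr => x _; rewrite /residual; ring.
Qed.

Lemma graph_volume_gt0 x : 0 < graph_volume G.
Proof.
rewrite /graph_volume (bigD1 x)//= ltr_pwDl ?vmeas_gt0//.
by apply: sumr_ge0 => y _; exact/ltW/vmeas_gt0.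
Qed.

(** * Sign of solutions and a necessary bound on lambda *)

Section MaximumPrinciple.
Variables (lam : R) (src : V -> R).
Hypotheses (lam_gt0 : 0 < lam) (src_ge0 : forall x, 0 <= src x).
Hypothesis src_mass_gt0 : 0 < \sum_x mu x * src x.

(** Strong maximum principle: at a maximum the Laplacian, hence [nonlin], is nonpositive. A zero of
    u would spread to its neighbours, hence everywhere, and force [src] to vanish. *)
Lemma solution_lt0 u : (forall x, residual lam src u x = 0) ->
  forall x, u x < 0.
Proof.
move=> sol x1.
have [m _ mmax] : exists2 m, true & forall x, u x <= u m.
  exists [arg max_(x > x1) u x]%O => //.
  by case: arg_maxP => // m _ h x; exact: h.
have lapE x : lap u x = lam * nonlin (u x) + src x.
  by have := sol x; rewrite /residual; lra.
have um0 : u m <= 0.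
  rewrite -nonlin_le0 -(pmulr_rle0 _ lam_gt0).
  have : mu m * lap u m <= 0.
    rewrite vmeas_laplacian; apply: sumr_le0 => y _.
    by rewrite mulr_ge0_le0 ?conductance_ge0// subr_le0.
  by rewrite (pmulr_rle0 _ (vmeas_gt0 G m)) lapE; have := src_ge0 m; lra.
have u0 x : u x <= 0 by apply: le_trans um0.
rewrite lt_neqAle u0 andbT; apply/eqP => ux1.
have {}u0 : forall x, u x = 0.
  apply: (graph_ind ux1) => x y xy ux.
  have : \sum_z conductance x z * - u z <= 0.
    have -> : \sum_z conductance x z * - u z = - (mu x * lap u x).
      rewrite vmeas_laplacian -sumrN; apply: eq_bigr => z _.
      by rewrite ux subr0 mulrN.
    rewrite oppr_le0 mulr_ge0 ?(ltW (vmeas_gt0 G x))//.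
    by rewrite lapE ux nonlin0 mulr0 add0r.
  have ge0 z : 0 <= conductance x z * - u z.
    by rewrite mulr_ge0 ?conductance_ge0// oppr_ge0.
  move=> le0; have /eqP : \sum_z conductance x z * - u z == 0.
    by rewrite eq_le le0 sumr_ge0.
  move/(psumr_eq0P (fun z _ => ge0 z))/(_ y isT)/eqP.
  by rewrite mulf_eq0 gt_eqF ?conductance_gt0//= oppr_eq0 => /eqP.
move: src_mass_gt0; rewrite big1 ?ltxx// => x _.
have := lapE x; rewrite u0 nonlin0 mulr0 add0r => <-.
by rewrite vmeas_laplacian big1// => y _; rewrite !u0 subrr mulr0.
Qed.

(** Integrating the equation removes the Laplacian, and [nonlin_ge] bounds the nonlinear term that
    must balance the source. *)
Lemma solution_lower_bound u : (forall x, residual lam src u x = 0) ->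
  6 ^+ 6 / 5 ^+ 5 * ((\sum_x mu x * src x) / graph_volume G) <= lam.
Proof.
move=> sol; have vol_gt0 : 0 < graph_volume G.
  have [x _|V0] := pickP V; first exact: graph_volume_gt0 x.
  by move: src_mass_gt0; rewrite big_pred0 ?ltxx.
have : 0 = \sum_x mu x * residual lam src u x.
  by rewrite big1// => x _; rewrite sol mulr0.
rewrite sum_residual => bal.
have : lam * (- (5 ^+ 5 / 6 ^+ 6 * graph_volume G)) <=
       lam * \sum_x mu x * nonlin (u x).
  rewrite ler_pM2l// /graph_volume mulr_sumr -sumrN; apply: ler_sum => x _.
  by rewrite -mulNr mulrC ler_pM2l ?vmeas_gt0// nonlin_ge.
rewrite mulrA ler_pdivrMr//; move: (\sum_x _ * src x) (\sum_x _) bal => S N.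
by lra.
Qed.

End MaximumPrinciple.
End Graph.

(** * From approximate solutions to solutions *)

Section Compactness.
Variables (R : realType) (V : finType) (G : weighted_graph R V).
Implicit Types (u v : V -> R) (x y : V).
Variables (lam : R) (src : V -> R).
Hypotheses (lam_gt0 : 0 < lam) (src_ge0 : forall x, 0 <= src x).
Hypothesis src_mass_gt0 : 0 < \sum_x vmeas G x * src x.

Local Notation mu := (vmeas G).
Local Notation lap := (graph_laplacian G).
Local Notation res := (residual G lam src).

(* A lower bound at a vertex propagates to its neighbours because the
   Laplacian is bounded from below there. *)
Lemma lower_bound_propagates (c A : R) x0 x : exists C : R, forall v,
  (forall y, v y <= 0) -> (forall y, - c <= res v y) -> - A <= v x0 ->
  - C <= v x.
Proof.
move: x; apply: (graph_ind (G := G) (x0 := x0)); first by exists A.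
move=> x y xy [C HC].
(* The residual bounds the Laplacian at x from below, and every other z satisfies v z - v x <= C
   because v <= 0. *)
pose K := mu x * (c + lam) + (\sum_(z | z != y) conductance G x z) * C.
have a0 := conductance_gt0 xy.
exists (C + K / conductance G x y) => v v0 rv vx0.
have {HC} vx := HC v v0 rv vx0.
have : mu x * - (c + lam) <= mu x * lap v x.
  rewrite ler_pM2l ?vmeas_gt0//; have := rv x; have := src_ge0 x.
  have : lam * -1 <= lam * nonlin (v x) by rewrite ler_pM2l// nonlin_geN1.
  by rewrite /residual; lra.
rewrite vmeas_laplacian (bigD1 y)//= => lapx.
have : \sum_(z | z != y) conductance G x z * (v z - v x) <=
       (\sum_(z | z != y) conductance G x z) * C.
  rewrite mulr_suml; apply: ler_sum => z _.
  by rewrite ler_wpM2l ?conductance_ge0//; have := v0 z; lra.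
move=> sumz; have : - K <= conductance G x y * (v y - v x) by rewrite /K; lra.
have -> : - K = conductance G x y * (- (K / conductance G x y)).
  by rewrite mulrN mulrC divfK// gt_eqF.
by rewrite ler_pM2l//; lra.
Qed.

Lemma small_residual_lower_bound : exists2 c : R, 0 < c & exists C : R,
  forall v, (forall x, v x <= 0) -> (forall x, `|res v x| <= c) ->
  forall x, - C <= v x.
Proof.
pose mass := \sum_x mu x * src x.
have mass0 : 0 < mass := src_mass_gt0.
have [x1 _|V0] := pickP V; last first.
  by move: mass0; rewrite /mass big_pred0 ?ltxx.
have vol0 := graph_volume_gt0 G x1.
(* If expR v < q everywhere, the residual integrates to at most -3/4 of [mass], whereas residuals >=
   -c give at least -1/2 of it. *)
pose q := mass / (4 * lam * graph_volume G).
have q0 : 0 < q by rewrite divr_gt0// !mulr_gt0.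
have qE : lam * (graph_volume G * q) = mass / 4.
  by rewrite /q; field; rewrite !gt_eqF.
pose c := mass / (2 * graph_volume G).
have cE : graph_volume G * c = mass / 2 by rewrite /c; field; rewrite gt_eqF.
exists c; first by rewrite divr_gt0// mulr_gt0.
(* The good vertex depends on v, so a constant is chosen for each pair of vertices; the sum of
   absolute values serves all pairs. *)
have /choice[f fP] : forall xy : V * V, exists C : R, forall v,
    (forall y, v y <= 0) -> (forall y, - c <= res v y) -> ln q <= v xy.1 ->
    - C <= v xy.2.
  move=> [x y]; have [C HC] := lower_bound_propagates c (- ln q) x y.
  by exists C => v ? ? h; apply: HC => //; rewrite opprK.
exists (\sum_xy `|f xy|) => v v0 rv x.
have rvN y : - c <= res v y by have := rv y; rewrite ler_norml => /andP[].
have [x0 vx0] : exists x0, ln q <= v x0.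
  apply: contrapT => /forallNP noq.
  have : \sum_y mu y * - q <= \sum_y mu y * nonlin (v y).
    apply: ler_sum => y _; rewrite ler_pM2l ?vmeas_gt0//.
    apply: le_trans (nonlin_geNexpR (v0 y)); rewrite lerN2 -[q]lnK ?posrE//.
    by rewrite ler_expR ltW// ltNge; apply/negP/noq.
  rewrite -mulr_suml -(ler_pM2l lam_gt0) mulrN mulrN qE.
  have : \sum_y mu y * - c <= \sum_y mu y * res v y.
    by apply: ler_sum => y _; rewrite ler_pM2l ?vmeas_gt0.
  rewrite sum_residual -mulr_suml mulrN cE -/mass.
  by move: mass0; lra.
apply: le_trans (fP (x0, x) v v0 rvN vx0); rewrite lerN2.
rewrite (bigD1 (x0, x))//= (le_trans (ler_norm _))// lerDl.
by apply: sumr_ge0.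
Qed.

(** The arbitrary filter covers both neighbourhoods of a function and those of a real parameter. *)
Lemma cvg_residual (T : Type) (F : set_system T) (FF : Filter F)
    (g : T -> V -> R) v x :
  (forall y, g s y @[s --> F] --> v y) -> res (g s) x @[s --> F] --> res v x.
Proof.
move=> gv; rewrite /residual; apply: cvgB; last exact: cvg_cst.
apply: cvgB.
  rewrite /graph_laplacian; apply: cvgMl_tmp.
  apply: (cvg_big (@add_continuous R)) => y _.
  by apply: cvgMl_tmp; apply: cvgB.
apply: cvgMl_tmp; rewrite /nonlin.
have ge : expR (g s x) @[s --> F] --> expR (v x).
  by apply: continuous_cvg (gv x); exact: continuous_expR.
apply: cvgM => //.
apply: (@continuous_cvg _ _ _ _ _ _ (fun z : R => z ^+ 5)).
  exact: exprn_continuous.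
by apply: cvgB => //; exact: cvg_cst.
Qed.

(** The solution need not satisfy P, but it is a limit of functions that do; this later places it
    relative to a subsolution. *)
Lemma approximate_solutions (P : (V -> R) -> Prop) :
  (forall e : R, 0 < e -> exists v,
    [/\ P v, forall x, v x <= 0 & forall x, `|res v x| <= e]) ->
  exists u, [/\ forall x, res u x = 0, forall x, u x <= 0 &
    forall d : R, 0 < d -> exists2 v, P v & forall x, `|u x - v x| < d].
Proof.
move=> approx; have [c c0 [C HC]] := small_residual_lower_bound.
(* In the pointwise topology Tychonoff makes the box compact, and finiteness of V makes pointwise
   closeness uniform. *)
pose T : topologicalType := {ptws V -> R}.
pose box : set T := [set v | forall x, `[- C, 0]%classic (v x)].
pose Q : set T := [set v : V -> R | P v /\ forall x, `[- C, 0]%classic (v x)].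
have approxQ e : 0 < e -> exists2 v, Q v & forall x, `|res v x| <= e.
  move=> e0; have [|v [Pv v0 rv]] := approx (Num.min c e).
    by rewrite lt_min c0.
  have {}rv x : `|res v x| <= c /\ `|res v x| <= e.
    by have := rv x; rewrite le_min => /andP[].
  exists v => [|x]; last by have [] := rv x.
  split=> // x; rewrite /= in_itv/= v0 andbT.
  by apply: HC => // y; have [] := rv y.
pose A := box `&` closure Q.
have cA : compact A.
  apply: compact_closedI; last exact: closed_closure.
  exact: (@tychonoff V (fun=> R) (fun=> `[- C, 0]%classic)
    (fun=> @segment_compact R (- C) 0)).
have QA : Q `<=` A.
  by move=> v Qv; split; [case: Qv|exact: subset_closure].
have projc (u : T) x : (v : T) x @[v --> u] --> u x.
  exact: (@proj_continuous V (fun=> R) x u).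
(* [A] contains functions with arbitrarily small residuals, so the minimum of [S] on it is 0 and a
   minimiser is an exact solution. *)
pose S (v : T) : R := \sum_x `|res v x|.
have cS : continuous S.
  move=> u; rewrite /continuous_at /S.
  have ru x : `|res v x| @[v --> nbhs (u : T)] --> `|res u x|.
    exact: cvg_norm (cvg_residual _ (projc u)).
  exact: (cvg_big (@add_continuous R) _ (fun x _ => ru x)).
have [v1 Qv1 _] := approxQ 1 ltr01.
have [] := compact_EVT_min (A := A) (f := S) _ cA (continuous_subspaceT cS).
  by exists v1; exact: QA.
move=> u; rewrite inE => -[ubox uQ] umin; exists u.
have Su0 : S u <= 0.
  apply/ler_addgt0Pl => e e0; rewrite addr0.
  have n0 : 0 < #|V|%:R + 1 :> R by rewrite ltr_wpDl.
  have [|v Qv rv] := approxQ (e / (#|V|%:R + 1)); first by rewrite divr_gt0.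
  apply: le_trans (umin v _) _; first by rewrite inE; exact: QA.
  apply: le_trans (ler_sum _ (fun x _ => rv x)) _.
  rewrite sumr_const -[X in X <= _]mulr_natr mulrAC ler_pdivrMr// ler_pM2l//.
  by rewrite lerDl.
split.
- move=> x; apply/eqP; rewrite -normr_le0; apply: le_trans Su0.
  by rewrite /S (bigD1 x)//= lerDl sumr_ge0.
- by move=> x; have := ubox x; rewrite /= in_itv/= => /andP[].
- move=> d d0.
  have near_u : nbhs (u : T) [set v : T | forall x, `|u x - v x| < d].
    apply: (@filter_forall T V (fun x v => `|u x - v x| < d) (nbhs (u : T)) _).
    by move=> x; exact: (cvgr_dist_lt _ _ (projc u x) _ d0).
  by have [v [[Pv _] dv]] := uQ _ near_u; exists v.
Qed.

End Compactness.

Lemma finite_pos_lower_bound (R : realType) (V : finType) (f : V -> R) :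
  (forall x, 0 < f x) -> exists2 d : R, 0 < d & forall x, d <= f x.
Proof.
move=> f0; pose S := \sum_x (f x)^-1 + 1.
have S1 x : (f x)^-1 <= S.
  rewrite /S (bigD1 x)//= -addrA lerDl addr_ge0//.
  by apply: sumr_ge0 => y _; rewrite invr_ge0 ltW.
have S0 : 0 < S.
  by rewrite ltr_wpDl// sumr_ge0// => y _; rewrite invr_ge0 ltW.
by exists S^-1 => [|x]; rewrite ?invr_gt0// invf_ple ?posrE.
Qed.

(** * The Euler map: order, energy and convergence of orbits *)

Section Flow.
Variables (R : realType) (V : finType) (G : weighted_graph R V).
Implicit Types (u v : V -> R) (x y : V).
Variables (lam : R) (src : V -> R).
Hypotheses (lam_gt0 : 0 < lam) (src_ge0 : forall x, 0 <= src x).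
Hypothesis src_mass_gt0 : 0 < \sum_x vmeas G x * src x.

Local Notation mu := (vmeas G).
Local Notation lap := (graph_laplacian G).
Local Notation res := (residual G lam src).
Local Notation energy := (graph_energy G lam src).

(** The sum over vertices stands in for a maximum. The factor 2 leaves half of the first-order
    energy decrease once second-order terms are paid for. *)
Definition time_step : R :=
  (2 * (\sum_x degree G x / mu x + 6 * lam))^-1.

Definition step u x : R := u x + time_step * res u x.

Lemma sum_degree_ge0 : 0 <= \sum_x degree G x / mu x.
Proof.
by apply: sumr_ge0 => x _; rewrite divr_ge0 ?degree_ge0// ltW ?vmeas_gt0.
Qed.

Lemma time_step_gt0 : 0 < time_step.
Proof.
rewrite invr_gt0 mulr_gt0// ltr_wpDl ?sum_degree_ge0// mulr_gt0//.
Qed.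

Lemma time_step_le x : time_step * (degree G x / mu x + 6 * lam) <= 2^-1.
Proof.
have := time_step_gt0; rewrite /time_step invr_gt0.
set S := \sum_x _ => S0.
have dS : degree G x / mu x <= S.
  rewrite /S (bigD1 x)//= lerDl; apply: sumr_ge0 => y _.
  by rewrite divr_ge0 ?degree_ge0// ltW ?vmeas_gt0.
rewrite mulrC ler_pdivrMr//; lra.
Qed.

(** The residual at x loses at most (degree/mu + 6 lam) (v x - u x), which the time step keeps below
    the gain v x - u x. *)
Lemma step_mono u v : (forall x, u x <= v x) -> (forall x, v x <= 0) ->
  forall x, step u x <= step v x.
Proof.
move=> uv v0 x; have t0 := time_step_gt0.
have lap_le : - (degree G x / mu x * (v x - u x)) <= lap v x - lap u x.
  rewrite -(ler_pM2l (vmeas_gt0 G x)) [leRHS]mulrBr !vmeas_laplacian.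
  have -> : mu x * - (degree G x / mu x * (v x - u x)) =
            - (degree G x * (v x - u x)).
    by field; rewrite gt_eqF ?vmeas_gt0.
  rewrite /degree mulr_suml -sumrN -sumrB; apply: ler_sum => y _.
  rewrite -subr_ge0.
  have -> : conductance G x y * (v y - v x) - conductance G x y * (u y - u x)
    - - (conductance G x y * (v x - u x)) = conductance G x y * (v y - u y).
    by ring.
  by rewrite mulr_ge0 ?conductance_ge0// subr_ge0.
have /ler_normlP[_] := nonlin_lip (uv x) (v0 x).
rewrite -(ler_pM2l lam_gt0) => nl.
have := uv x; rewrite -subr_ge0 => /ler_wpM2r/(_ _ _ (time_step_le x)) tl.
rewrite /step /residual -subr_ge0.
have : time_step * (- (degree G x / mu x * (v x - u x))
          - lam * (6 * (v x - u x))) <=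
       time_step * ((lap v x - lap u x) - lam * (nonlin (v x) - nonlin (u x))).
  by rewrite ler_pM2l//; lra.
have := uv x; lra.
Qed.

(** The zero function is a supersolution, so comparison with its image suffices. *)
Lemma step_le0 v : (forall x, v x <= 0) -> forall x, step v x <= 0.
Proof.
move=> v0 x; apply: le_trans (step_mono (v := fun=> 0) v0 _ x) _ => //.
rewrite /step /residual nonlin0 mulr0 subr0 add0r mulr_ge0_le0//.
  exact/ltW/time_step_gt0.
rewrite /graph_laplacian big1 => [|y _]; rewrite ?subrr mulr0//.
by rewrite sub0r oppr_le0.
Qed.

(** The first-order change is minus the time step times the weighted sum of squared residuals; by
    [time_step_le] the second-order terms cost at most half of it. *)
Lemma energy_step v : (forall x, v x <= 0) ->
  energy (step v) <=
    energy v - time_step / 2 * \sum_x mu x * res v x ^+ 2.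
Proof.
move=> v0; have t0 := time_step_gt0; have s0 := step_le0 v0.
rewrite /graph_energy dirichletD.
have := dirichlet_le G (fun x => time_step * res v x).
set D := dirichlet _ _; set E := dirichlet _ _ => Dle.
suff : D + \sum_x mu x * (lam * nonlin_primitive (step v x) + src x * step v x)
    <= \sum_x mu x * lap v x * (time_step * res v x)
     + \sum_x mu x * (lam * nonlin_primitive (v x) + src x * v x)
     - time_step / 2 * \sum_x mu x * res v x ^+ 2 by lra.
apply: le_trans (lerD Dle (lexx _)) _.
rewrite mulr_sumr -!big_split/= -sumrB; apply: ler_sum => x _.
have F := nonlin_primitive_taylor (v0 x) (s0 x).
have {F} : mu x * lam *
    (nonlin_primitive (step v x) - nonlin_primitive (v x)) <=
  mu x * lam * (nonlin (v x) * (step v x - v x) + 6 * (step v x - v x) ^+ 2).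
  by rewrite ler_pM2l// mulr_gt0 ?vmeas_gt0.
have -> : step v x - v x = time_step * res v x by rewrite /step; ring.
have lapE : lap v x = res v x + lam * nonlin (v x) + src x.
  by rewrite /residual; ring.
have : mu x * time_step * res v x ^+ 2 *
      (time_step * (degree G x / mu x + 6 * lam)) <=
      mu x * time_step * res v x ^+ 2 * 2^-1.
  apply: ler_wpM2l (time_step_le x).
  by rewrite mulr_ge0 ?sqr_ge0// mulr_ge0// ltW ?vmeas_gt0.
have -> : mu x * time_step * res v x ^+ 2 *
      (time_step * (degree G x / mu x + 6 * lam)) =
    degree G x * (time_step * res v x) ^+ 2 +
    mu x * lam * (6 * (time_step * res v x) ^+ 2).
  by field; rewrite gt_eqF ?vmeas_gt0.
by rewrite lapE [in src x * step v x]/step; lra.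
Qed.

Lemma iter_step_le0 n v : (forall x, v x <= 0) ->
  forall x, iter n step v x <= 0.
Proof. by move=> v0; elim: n => //= n; exact: step_le0. Qed.

Lemma energy_iter_step m n v : (forall x, v x <= 0) ->
  energy (iter (m + n) step v) <= energy (iter n step v).
Proof.
move=> v0; elim: m => //= m ih; apply: le_trans ih.
apply: le_trans (energy_step (iter_step_le0 (m + n) v0)) _.
rewrite lerBlDr lerDl mulr_ge0 ?divr_ge0 ?(ltW time_step_gt0)//.
by apply: sumr_ge0 => x _; rewrite mulr_ge0 ?sqr_ge0// ltW ?vmeas_gt0.
Qed.

(** Otherwise each step would lower the energy by a fixed amount, and it would eventually fall below
    m. *)
Lemma orbit_small_residual (m : R) v : (forall x, v x <= 0) ->
  (forall n, m <= energy (iter n step v)) ->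
  forall e, 0 < e -> exists n, forall x, `|res (iter n step v) x| <= e.
Proof.
move=> v0 mE e e0; have [d d0 dmu] := finite_pos_lower_bound (vmeas_gt0 G).
have t0 := time_step_gt0.
pose w n := iter n step v; pose D n := \sum_x mu x * res (w n) x ^+ 2.
(* The lower bound d on the measure turns a bound on the weighted sum into a pointwise one. *)
have [n Dn] : exists n, D n <= d * e ^+ 2.
  apply: contrapT => /forallNP Dbig.
  have En n : energy (w n) <= energy v - n%:R * (time_step / 2 * (d * e ^+ 2)).
    elim: n => [|n ih]; first by rewrite mul0r subr0.
    apply: le_trans (energy_step (iter_step_le0 n v0)) _.
    have : time_step / 2 * (d * e ^+ 2) <= time_step / 2 * D n.
      rewrite ler_pM2l ?divr_gt0// ltW// ltNge; exact/negP/Dbig.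
    by rewrite -/(w n) -/(D n) -[n.+1%:R]natr1; lra.
  have c0 : 0 < time_step / 2 * (d * e ^+ 2).
    by rewrite mulr_gt0 ?divr_gt0// mulr_gt0// exprn_gt0.
  have := archi_boundP
    (x := `|energy v - m| / (time_step / 2 * (d * e ^+ 2))).
  rewrite divr_ge0// ?(ltW c0)// => /(_ isT); set n := Num.bound _.
  rewrite ltr_pdivrMr// => nbig; have := le_trans (mE n) (En n).
  by have := ler_norm (energy v - m); lra.
exists n => x; rewrite -(ler_pXn2r (n := 2))// ?nnegrE// ?(ltW e0)//.
rewrite real_normK ?num_real// -(ler_pM2l d0); apply: le_trans Dn.
rewrite /D (bigD1 x)//= -[leLHS]addr0; apply: lerD.
  by rewrite ler_wpM2r ?sqr_ge0.
by apply: sumr_ge0 => y _; rewrite mulr_ge0 ?sqr_ge0// ltW ?vmeas_gt0.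
Qed.

(** * Continuity of the iterates and of the energy *)

Section Continuity.
Variables (T : Type) (F : set_system T) (FF : Filter F).
Variables (g : T -> V -> R) (v : V -> R).
Hypothesis gv : forall y, g s y @[s --> F] --> v y.

Lemma cvg_iter_step n x : iter n step (g s) x @[s --> F] --> iter n step v x.
Proof.
elim: n x => [|n ih] x /=; first exact: gv.
rewrite /step; apply: cvgD; first exact: ih.
by apply: cvgMl_tmp; apply: cvg_residual.
Qed.

Lemma cvg_energy : energy (g s) @[s --> F] --> energy v.
Proof.
rewrite /graph_energy /dirichlet; apply: cvgD.
  apply: cvgMl_tmp; apply: (cvg_big (@add_continuous R)) => x _.
  apply: (cvg_big (@add_continuous R)) => y _; apply: cvgMl_tmp.
  apply: (@continuous_cvg _ _ _ _ _ _ (fun z : R => z ^+ 2)).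
    exact: exprn_continuous.
  exact: cvgB.
apply: (cvg_big (@add_continuous R)) => x _; apply: cvgMl_tmp.
apply: cvgD; last exact: cvgMl_tmp.
apply: cvgMl_tmp; apply: cvgMr_tmp.
apply: (@continuous_cvg _ _ _ _ _ _ (fun z : R => z ^+ 6)).
  exact: exprn_continuous.
have ge : expR (g s x) @[s --> F] --> expR (v x).
  by apply: continuous_cvg (@gv x); exact: continuous_expR.
by apply: cvgB => //; exact: cvg_cst.
Qed.

End Continuity.

Lemma step_solution u : (forall x, res u x = 0) -> step u = u.
Proof. by move=> u0; apply/funext => x; rewrite /step u0 mulr0 addr0. Qed.

Lemma energy_ge u v : (forall x, u x <= v x) ->
  \sum_x mu x * src x * u x <= energy v.
Proof.
move=> uv; rewrite /graph_energy -[leLHS]add0r lerD ?dirichlet_ge0//.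
apply: ler_sum => x _; rewrite -mulrA ler_pM2l ?vmeas_gt0//.
rewrite -[leLHS]add0r lerD ?ler_wpM2l//.
by rewrite mulr_ge0 ?(ltW lam_gt0)// nonlin_primitive_ge0.
Qed.

(** By monotonicity the orbit of a subsolution stays above it, so its energy is bounded below; lying
    above u passes to the limit. *)
Lemma solution_above u : (forall x, u x <= 0) -> (forall x, 0 <= res u x) ->
  exists2 v, forall x, res v x = 0 & forall x, u x <= v x.
Proof.
move=> u0 ru.
have step_ge x : u x <= step u x.
  by rewrite lerDl mulr_ge0// ltW ?time_step_gt0.
have iter_ge n x : u x <= iter n step u x.
  elim: n x => //= n ih x; apply: le_trans (step_ge x) _.
  by apply: step_mono => //; exact: iter_step_le0.
have [|v [v0 _ vP]] := approximate_solutions (G := G)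
    lam_gt0 src_ge0 src_mass_gt0 (P := fun v => forall x, u x <= v x).
  move=> e e0.
  have [n rn] := orbit_small_residual u0 (fun n => energy_ge (iter_ge n)) e0.
  exists (iter n step u); split => //; exact: iter_step_le0.
exists v => // x; apply/ler_addgt0Pl => d d0.
have [w uw /(_ x)] := vP d d0; rewrite ltr_norml => /andP[h1 h2].
by have := uw x; lra.
Qed.

(** Shooting along u - s: for s1, the supremum of the parameters whose orbit climbs above u, the
    orbit never does so, yet its energy stays at least [m]. *)
Lemma solution_not_above u :
  (forall x, u x <= 0) -> (forall x, 0 < res u x) ->
  exists2 v, forall x, res v x = 0 & ~ (forall x, u x <= v x).
Proof.
move=> u0 ru.
have step_gt x : u x < step u x by rewrite ltrDl mulr_gt0 ?time_step_gt0.
have above_step w : (forall x, w x <= 0) -> (forall x, u x <= w x) ->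
    forall x, u x < step w x.
  by move=> w0 uw x; apply: lt_le_trans (step_gt x) (step_mono uw w0 x).
have above_iter n w : (forall x, w x <= 0) -> (forall x, u x <= w x) ->
    forall x, u x <= iter n step w x.
  move=> w0 uw; elim: n => //= n ih x; apply/ltW.
  by apply: above_step => //; exact: iter_step_le0.
pose m := \sum_x mu x * src x * u x.
pose g (s : R) x := u x - s.
have g0 s : 0 <= s -> forall x, g s x <= 0.
  by move=> s0 x; rewrite /g; have := u0 x; lra.
have gmono s t : s <= t -> forall x, g t x <= g s x.
  by move=> st x; rewrite /g; lra.
have gcvg (s : R) y : g t y @[t --> s] --> g s y.
  by rewrite /g; apply: cvgB; [exact: cvg_cst|exact: cvg_id].
pose S : set R :=
  [set s | 0 <= s /\ exists n, forall x, u x <= iter n step (g s) x].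
have S0 : S 0 by split=> //; exists 0%N => x /=; rewrite /g subr0.
(* Once above u the orbit stays there, with energy at least [m]; as the energy never increases,
   earlier values are at least [m] too. *)
have SP s n : S s -> m <= energy (iter n step (g s)).
  move=> [s0 [k uk]]; have uN := above_iter n _ (iter_step_le0 k (g0 s s0)) uk.
  rewrite -iterD addnC in uN.
  exact: le_trans (energy_ge uN) (energy_iter_step k n (g0 s s0)).
have Sub : has_sup S.
  split; first by exists 0.
  (* Along the half-line the Dirichlet part is constant and the source term falls linearly in s, so
     energy >= [m] limits s. *)
  exists ((dirichlet G u + lam * graph_volume G) / \sum_x mu x * src x).
  move=> s Ss; rewrite ler_pdivlMr//; have [s0 _] := Ss.
  have := SP s 0%N Ss; rewrite /graph_energy /=.
  have -> : dirichlet G (g s) = dirichlet G u.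
    rewrite /dirichlet; congr (_ * _); apply: eq_bigr => x _.
    by apply: eq_bigr => y _; rewrite /g; congr (_ * _); ring.
  have : \sum_x mu x * (lam * nonlin_primitive (g s x) + src x * g s x) <=
      lam * graph_volume G + m - s * \sum_x mu x * src x.
    rewrite /m /graph_volume !mulr_sumr -big_split/= -sumrB.
    apply: ler_sum => x _.
    have : mu x * lam * nonlin_primitive (g s x) <= mu x * lam * 1.
      rewrite ler_pM2l ?mulr_gt0 ?vmeas_gt0//.
      exact/nonlin_primitive_le1/g0.
    by rewrite /g; lra.
  by lra.
pose s1 := sup S.
have s1_ge0 : 0 <= s1 by apply: sup_upper_bound S0.
(* If the orbit of s1 reached u, it would be strictly above one step later, and so would orbits of
   slightly larger s, beyond the supremum. *)
have nS n : ~ (forall x, u x <= iter n step (g s1) x).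
  move=> un.
  have near_s1 : \forall s \near s1, forall x, u x < iter n.+1 step (g s) x.
    apply: (@filter_forall R V (fun x s => u x < iter n.+1 step (g s) x)
      (nbhs s1) _) => x.
    apply: (@cvgr_gt R R (nbhs s1) _ (fun s => iter n.+1 step (g s) x)
      _ (cvg_iter_step _ (gcvg s1) (n := n.+1) (x := x))).
    by apply: above_step => //; exact/iter_step_le0/g0.
  have /nbhs_ballP[d /= d0 ball_d] := near_s1.
  have : S (s1 + d / 2).
    split; first by rewrite addr_ge0// divr_ge0// ltW.
    exists n.+1 => x; apply/ltW; apply: ball_d.
    rewrite /ball/= opprD addrA subrr sub0r normrN.
    by rewrite gtr0_norm ?divr_gt0//; lra.
  by move=> /(sup_upper_bound Sub); rewrite -/s1; lra.
(* An energy below [m] at s1 would persist at nearby points of [S], against [SP]. *)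
have mE n : m <= energy (iter n step (g s1)).
  rewrite leNgt; apply/negP => Em.
  have near_s1 : \forall s \near s1, energy (iter n step (g s)) < m.
    apply: (@cvgr_lt R R (nbhs s1) _ (fun s => energy (iter n step (g s)))
      _ (cvg_energy _ _)) Em => y.
    exact: (cvg_iter_step _ (gcvg s1) (n := n) (x := y)).
  have /nbhs_ballP[d /= d0 ball_d] := near_s1.
  have [s Ss sd] := sup_adherent d0 Sub.
  have := SP s n Ss; rewrite leNgt => /negP; apply; apply: ball_d.
  have := sup_upper_bound Sub Ss; rewrite -/s1 in sd * => ss1.
  by rewrite /ball/= ger0_norm; lra.
have [|v [v0 v_le0 vP]] := approximate_solutions (G := G)
    lam_gt0 src_ge0 src_mass_gt0 (P := fun v => exists x, v x < u x).
  move=> e e0.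
  have [n rn] := orbit_small_residual (g0 s1 s1_ge0) mE e0.
  exists (iter n step (g s1)); split => //; last exact/iter_step_le0/g0.
  apply: contrapT => /forallNP h; apply: (nS n) => x.
  by rewrite leNgt; apply/negP/h.
exists v => // uv.
(* A fixed point of [step] above u exceeds it by a uniform gap, which excludes approximants dipping
   below u. *)
have {}uv x : 0 < v x - u x.
  by rewrite subr_gt0 -(step_solution v0); exact: above_step.
have [d d0 dP] := finite_pos_lower_bound uv.
have [w [x wx] /(_ x)] := vP d d0; rewrite ltr_norml => /andP[h1 h2].
by have := dP x; lra.
Qed.

End Flow.

(** * The critical value as an infimum *)

Section CriticalValue.
Variables (R : realType) (V : finType) (G : weighted_graph R V).
Variable src : V -> R.
Hypothesis src_ge0 : forall x, 0 <= src x.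
Hypothesis src_mass_gt0 : 0 < \sum_x vmeas G x * src x.

Local Notation solves lam u := (forall x, residual G lam src u x = 0).

Lemma residual_shift (l lam : R) (u : V -> R) : solves l u ->
  forall x, residual G lam src u x = (l - lam) * nonlin (u x).
Proof. by move=> lu x; have := lu x; rewrite /residual; lra. Qed.

(** As u < 0 makes [nonlin] negative, u has positive residual at lam: it is a strict subsolution,
    fit for both constructions. *)
Lemma two_solutions (l lam : R) (u : V -> R) : 0 < l -> l < lam -> solves l u ->
  exists v w, [/\ v <> w, solves lam v & solves lam w].
Proof.
move=> l0 llam lu; have lam0 := lt_trans l0 llam.
have u_lt0 := solution_lt0 l0 src_ge0 src_mass_gt0 lu.
have u0 x : u x <= 0 by exact/ltW/u_lt0.
have ru x : 0 < residual G lam src u x.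
  by rewrite (residual_shift _ lu) nmulr_lgt0 ?nonlin_lt0// subr_lt0.
have [v vsol uv] :=
  solution_above lam0 src_ge0 src_mass_gt0 u0 (fun x => ltW (ru x)).
have [w wsol uw] := solution_not_above lam0 src_ge0 src_mass_gt0 u0 ru.
by exists v, w; split=> // vw; apply: uw; rewrite -vw.
Qed.

Lemma solvable_large : exists lam : R, 0 < lam /\ exists u, solves lam u.
Proof.
have n0 : nonlin (-1 : R) < 0 by apply: nonlin_lt0; lra.
(* [S] dominates [src] everywhere, so the constant -1 is a subsolution at the chosen parameter; the
   + 1 makes [S] positive. *)
pose S := \sum_x src x + 1.
have S0 : 0 < S by rewrite ltr_wpDl// sumr_ge0.
have lam0 : 0 < S / - nonlin (-1) by rewrite divr_gt0// oppr_gt0.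
exists (S / - nonlin (-1)); split=> //.
have [|x|v vsol _] := solution_above lam0 src_ge0 src_mass_gt0 (u := fun=> -1).
- by move=> _; lra.
- rewrite /residual /graph_laplacian.
  rewrite big1 => [|y _]; rewrite ?subrr mulr0// sub0r -mulrN.
  rewrite divfK ?oppr_eq0 ?lt_eqF// subr_ge0 /S (bigD1 x)//= -addrA lerDl.
  by rewrite addr_ge0// sumr_ge0.
- by exists v.
Qed.

Lemma critical_value : exists lam_hat : R,
  [/\ 6 ^+ 6 / 5 ^+ 5 * ((\sum_x vmeas G x * src x) / graph_volume G)
        <= lam_hat,
      forall lam, lam_hat < lam ->
        exists v w, [/\ v <> w, solves lam v & solves lam w],
      exists u, solves lam_hat u
    & forall lam, 0 < lam -> lam < lam_hat -> ~ exists u, solves lam u].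
Proof.
pose L : set R := [set lam | 0 < lam /\ exists u, solves lam u].
pose b := 6 ^+ 6 / 5 ^+ 5 * ((\sum_x vmeas G x * src x) / graph_volume G).
have lbL : lbound L b.
  by move=> l [l0 [u lu]]; have := solution_lower_bound l0 src_mass_gt0 lu.
have L0 : nonempty L by have [l Ll] := solvable_large; exists l.
have infL : has_inf L by split => //; exists b.
have b0 : 0 < b.
  rewrite mulr_gt0 ?divr_gt0 ?exprn_gt0//.
  have [x _|V0] := pickP V; first exact: graph_volume_gt0 x.
  by move: src_mass_gt0; rewrite big_pred0 ?ltxx.
have bL : b <= inf L by exact: lb_le_inf.
have lam0 : 0 < inf L by exact: lt_le_trans bL.
have near_inf e : 0 < e -> exists l u,
    [/\ inf L <= l, l < inf L + e, 0 < l & solves l u].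
  move=> e0; have [l Ll le] := inf_adherent e0 infL.
  have [l0 [u lu]] := Ll; exists l, u; split=> //.
  by apply: ge_inf => //; exists b.
exists (inf L); split=> //.
- move=> lam; rewrite -subr_gt0 => /near_inf[l [u [_ llam l0 lu]]].
  by apply: two_solutions l0 _ lu; lra.
(* A solution at l has residual (l - inf L) nonlin(u) at inf L, of size at most l - inf L since
   nonlin(u) lies in [-1, 0]. *)
- have [|u [u0 _ _]] := approximate_solutions lam0 src_ge0 src_mass_gt0
    (P := fun=> True).
    move=> e e0; have [l [u [il le l0 lu]]] := near_inf e e0.
    have u_lt0 := solution_lt0 l0 src_ge0 src_mass_gt0 lu.
    exists u; split=> // x; first exact/ltW/u_lt0.
    rewrite (residual_shift _ lu) normrM ger0_norm ?subr_ge0//.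
    apply: (@le_trans _ _ ((l - inf L) * 1)); last by lra.
    rewrite ler_wpM2l ?subr_ge0// ler_norml nonlin_geN1/=.
    by apply: (@le_trans _ _ 0) => //; exact/ltW/nonlin_lt0.
  by exists u.
- move=> lam lam_gt0 laminf [u lu]; have : L lam by split=> //; exists u.
  by move/(ge_inf (ex_intro _ b lbL)); rewrite leNgt laminf.
Qed.

End CriticalValue.

(** * Dirac masses as the source, and the conclusion *)

Section DiracSource.
Variables (R : realType) (V : finType) (G : weighted_graph R V).
Variables (N : nat) (p : 'I_N -> V).

Definition vortex_source x : R := 4 * pi * \sum_(s < N) dirac_mass G (p s) x.

Lemma vortex_source_ge0 x : 0 <= vortex_source x.
Proof.
rewrite mulr_ge0 ?mulr_ge0 ?pi_ge0//; apply: sumr_ge0 => s _.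
by rewrite /dirac_mass; case: ifP => // _; rewrite invr_ge0 ltW ?vmeas_gt0.
Qed.

Lemma vortex_source_mass :
  \sum_x vmeas G x * vortex_source x = 4 * pi * N%:R.
Proof.
rewrite /vortex_source.
have -> : \sum_x vmeas G x * (4 * pi * \sum_(s < N) dirac_mass G (p s) x) =
    4 * pi * \sum_(s < N) \sum_x vmeas G x * dirac_mass G (p s) x.
  rewrite exchange_big/= mulr_sumr; apply: eq_bigr => x _.
  by rewrite -mulr_sumr; ring.
congr (_ * _); rewrite (eq_bigr (fun=> 1)) => [|s _].
  by rewrite sumr_const card_ord.
rewrite (bigD1 (p s))//= /dirac_mass eqxx divff ?gt_eqF ?vmeas_gt0//.
by rewrite big1 ?addr0// => x /negbTE ->; rewrite mulr0.
Qed.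

Lemma is_solutionP (lam : R) u :
  is_solution G p lam u <-> (forall x, residual G lam vortex_source u x = 0).
Proof.
by split=> h x; have := h x;
  rewrite /residual /vortex_source /nonlin => ?; lra.
Qed.

End DiracSource.

Theorem theorem1p1 (R : realType) (V : finType) (G : weighted_graph R V)
    (N : nat) (N_ge1 : (1 <= N)%N) (p : 'I_N -> V) (p_inj : injective p) :
  exists lambda_hat : R,
    [/\ lambda_hat >= 6 ^+ 6 / 5 ^+ 5 * (4 * pi * N%:R / graph_volume G),
        forall lambda : R, lambda_hat < lambda ->
          exists u v : V -> R,
            [/\ u <> v, is_solution G p lambda u & is_solution G p lambda v],
        exists u : V -> R, is_solution G p lambda_hat u
      & forall lambda : R, 0 < lambda -> lambda < lambda_hat ->
          ~ exists u : V -> R, is_solution G p lambda u].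
Proof.
have mass0 : 0 < \sum_x vmeas G x * vortex_source G p x.
  by rewrite vortex_source_mass !mulr_gt0 ?pi_gt0// ltr0n.
have [lam_hat [bound two one none]] :=
  critical_value (vortex_source_ge0 G p) mass0.
exists lam_hat; split.
- by move: bound; rewrite vortex_source_mass.
- move=> lam /two[v [w [vw vsol wsol]]]; exists v, w.
  by split=> //; apply/is_solutionP.
- by have [u usol] := one; exists u; apply/is_solutionP.
- move=> lam lam0 /(none lam lam0) no [u /is_solutionP usol].
  by apply: no; exists u.
Qed.
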